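(* Let $G$ be a connected simple graph with $n\ge 2$ vertices, and let $\Phi=\{\phi_i\}_{i\in[n]}$ be an $L_G(n,n-1)$-frame for $\mathbb{C}^{n-1}$. Then the canonical dual frame of $\Phi$ is the unique spectrally optimal dual frame of $\Phi$ for $1$-erasure. Further, $\rho^{(1)}_\Phi=\frac{n-1}{n}$.
   Context: Write $[n]=\{1,\dots,n\}$; inner products on $\mathbb{C}^d$ are standard and linear in the first argument. A finite sequence $\Phi=\{\phi_i\}_{i\in[n]}$ in $\mathbb{C}^d$ is a frame for $\mathbb{C}^d$ if there are constants $0<A\le B$ with $A\|f\|^2\le\sum_{i\in[n]}|\langle f,\phi_i\rangle|^2\le B\|f\|^2$ for all $f\in\mathbb{C}^d$. Its frame operator is $S_\Phi f=\sum_{i\in[n]}\langle f,\phi_i\rangle\phi_i$ (invertible). A frame $\Psi=\{\psi_i\}_{i\in[n]}$ of $\mathbb{C}^d$ is a dual frame of $\Phi$ if $f=\sum_{i\in[n]}\langle f,\phi_i\rangle\psi_i=\sum_{i\in[n]}\langle f,\psi_i\rangle\phi_i$ for all $f\in\mathbb{C}^d$; $D_\Phi$ denotes the set of dual frames of $\Phi$. The canonical dual frame of $\Phi$ is $S_\Phi^{-1}\Phi:=\{S_\Phi^{-1}\phi_i\}_{i\in[n]}\in D_\Phi$. Spectral optimality: for $\Psi\in D_\Phi$ and $\Lambda\subset[n]$, the error operator is $E_{\Phi,\Psi,\Lambda}(f)=\sum_{i\in\Lambda}\langle f,\phi_i\rangle\psi_i$ on $\mathbb{C}^d$, and for $1\le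 r<n$, $\rho^{(r)}_{\Phi,\Psi}:=\max\{\rho(E_{\Phi,\Psi,\Lambda}):\Lambda\subset[n],\ |\Lambda|=r\}$, where $\rho(\cdot)$ is the spectral radius. Put $\rho^{(r)}_\Phi:=\min\{\rho^{(r)}_{\Phi,\widetilde\Psi}:\widetilde\Psi\in D_\Phi\}$. $\Psi\in D_\Phi$ is a spectrally optimal dual frame of $\Phi$ for $1$-erasure if $\rho^{(1)}_{\Phi,\Psi}=\rho^{(1)}_\Phi$. Graph frames: for a simple graph $G$ with $n$ vertices $v_1,\dots,v_n$ and $n-k$ connected components, the Laplacian matrix is $L(G)=D(G)-A(G)$ (degree matrix minus adjacency matrix); it has rank $k$. Write $L(G)=M\,\mathrm{diag}(\lambda_1,\dots,\lambda_k,0,\dots,0)\,M^*$ with $M$ unitary and $\lambda_1,\dots,\lambda_k$ the nonzero eigenvalues, let $M_1$ be the submatrix formed by the first $k$ columns of $M$, and let $B=\mathrm{diag}(\sqrt{\lambda_1},\dots,\sqrt{\lambda_k})M_1^*$. Then $\{B e_i\}_{i\in[n]}$, with $\{e_i\}$ the standard basis of $\mathbb{C}^n$, is a frame for $\mathbb{C}^k$; any frame arising in this way is called an $L_G(n,k)$-frame. *)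

(* Defs.v *)
From HB Require Import structures.
From mathcomp Require Import all_boot all_order all_algebra.
From mathcomp Require Export sesquilinear spectral.
From mathcomp Require Import all_classical all_reals.
From mathcomp Require Export complex.

Set Implicit Arguments.
Unset Strict Implicit.
Unset Printing Implicit Defensive.

Import Order.TTheory GRing.Theory Num.Theory.
Local Open Scope classical_set_scope.
Local Open Scope complex_scope.
Local Open Scope ring_scope.
Local Open Scope sesquilinear_scope.

Section Frames.
Variables (R : realType) (d n : nat).
Local Notation C := R[i].
Implicit Types (f g : 'cV[C]_d) (Phi Psi : 'I_n -> 'cV[C]_d).
Implicit Types (L : {set 'I_n}) (r : nat).

Definition inner f g : C := \sum_(j < d) f j 0 * (g j 0)^*.

(* Inequalities between elements of R[i] entail that both sides differ by a
   real number; here all three terms are real. *)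
Definition is_frame Phi : Prop :=
  exists A B : R, [/\ 0 < A, A <= B & forall f,
    A%:C * inner f f <= \sum_(i < n) `|inner f (Phi i)| ^+ 2 <= B%:C * inner f f].

Definition partial_sum Phi Psi L f : 'cV[C]_d :=
  \sum_(i in L) inner f (Phi i) *: Psi i.

Lemma partial_sum_is_linear Phi Psi L : linear (partial_sum Phi Psi L).
Proof.
move=> a f g; rewrite /partial_sum scaler_sumr -big_split /=.
apply: eq_bigr => i _; rewrite scalerA -scalerDl; congr (_ *: _).
rewrite /inner mulr_sumr -big_split /=; apply: eq_bigr => j _.
by rewrite !mxE mulrDl mulrA.
Qed.

HB.instance Definition _ Phi Psi L :=
  GRing.isLinear.Build C 'cV[C]_d 'cV[C]_d *:%R (partial_sum Phi Psi L)
    (partial_sum_is_linear Phi Psi L).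

Definition error_op Phi Psi L : 'End('cV[C]_d) :=
  linfun (partial_sum Phi Psi L).

Definition frame_op Phi : 'End('cV[C]_d) :=
  linfun (partial_sum Phi Phi [set: 'I_n]%SET).

Definition is_dual_frame Phi Psi : Prop :=
  is_frame Psi /\
  forall f, f = \sum_(i < n) inner f (Phi i) *: Psi i /\
            f = \sum_(i < n) inner f (Psi i) *: Phi i.

(* For a frame Phi the frame operator is bijective, so that the one-sided
   inverse of the library is its inverse. *)
Definition canonical_dual Phi : 'I_n -> 'cV[C]_d :=
  fun i => (frame_op Phi)^-1%VF (Phi i).

Definition spectral_radius (T : 'End('cV[C]_d)) : R :=
  sup [set Normc.normc a | a in [set a : C | passmx.leigenvalue T a]].

(* Spectral radii are nonnegative, so 0 is a harmless default value for the
   maximum over the sets L of cardinality r. *)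
Definition rho_dual r Phi Psi : R :=
  \big[Num.max/0]_(L : {set 'I_n} | #|L| == r)
    spectral_radius (error_op Phi Psi L).

(* The values are bounded below by 0 and there is at least one for a frame
   Phi; the infimum is a minimum as soon as a spectrally optimal dual frame
   exists. *)
Definition rho r Phi : R :=
  inf [set rho_dual r Phi Psi | Psi in [set Psi | is_dual_frame Phi Psi]].

Definition spectrally_optimal r Phi Psi : Prop :=
  is_dual_frame Phi Psi /\ rho_dual r Phi Psi = rho r Phi.

End Frames.

Section Graphs.
Variables (R : realType) (n : nat).
Local Notation C := R[i].

Definition simple_graph (e : rel 'I_n) : Prop := symmetric e /\ irreflexive e.

Definition connected_graph (e : rel 'I_n) : Prop := forall x y, connect e x y.

Definition degree_mx (e : rel 'I_n) : 'M[C]_n :=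
  diag_mx (\row_i #|[set j | e i j]%SET|%:R).

Definition adjacency_mx (e : rel 'I_n) : 'M[C]_n := \matrix_(i, j) (e i j)%:R.

Definition laplacian (e : rel 'I_n) : 'M[C]_n := degree_mx e - adjacency_mx e.

(* The diagonal lam = (lam_1, ..., lam_k, 0, ..., 0) has exactly its first k
   entries nonzero. *)
Definition is_LG_frame (e : rel 'I_n) (k : nat) (Phi : 'I_n -> 'cV[C]_k) : Prop :=
  (n_comp e predT + k = n)%N /\
  exists (le_kn : (k <= n)%N) (M : 'M[C]_n) (lam : 'rV[R]_n),
  [/\ M \is unitarymx,
      forall j : 'I_n, (lam 0 j != 0) = (j < k)%N,
      laplacian e = M *m diag_mx (map_mx (real_complex R) lam) *m M^t* &
      let M1 := colsub (widen_ord le_kn) M in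
      let B := diag_mx (\row_(j < k) (Num.sqrt (lam 0 (widen_ord le_kn j)))%:C)
                 *m M1^t* in
      forall i : 'I_n, Phi i = B *m delta_mx i 0].

End Graphs.

(* Main.v *)
Require Import Defs.
From mathcomp Require Import all_boot all_order all_algebra.
From mathcomp Require Import all_classical all_reals.
From mathcomp Require Import ring.

Import Order.TTheory GRing.Theory Num.Theory.
Local Open Scope ring_scope.
Local Open Scope sesquilinear_scope.

(* Since L(G) = B^* B kills the all-ones vector 1 and has rank n - 1, the frame
   vectors sum to 0 and the projection onto the row space of B is I - J / n.
   Hence the canonical dual Q satisfies <Q_i, phi_i> = (n - 1) / n for every i,
   and every dual frame is Q_i + u for one vector u independent of i. The
   1-erasure error operators have rank at most one, with spectral radius
   |<psi_i, phi_i>| = |c + x_i|, where c = (n - 1) / n and x_i = <u, phi_i> has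
   zero sum; as \sum |c + x_i|^2 = n c^2 + \sum |x_i|^2, the maximum is at
   least c, with equality only if all x_i vanish, that is if u = 0. *)

(** * Two preliminaries: an extremal inequality and eigenvalues *)

Lemma zero_sum_ball (C : numClosedFieldType) (I : finType) (c : C)
    (x : I -> C) :
  0 <= c -> \sum_i x i = 0 -> (forall i, `|c + x i| <= c) ->
  forall i, x i = 0.
Proof.
move=> c0 x0 xc.
have cJ : c^* = c by apply/conj_Creal/ger0_real.
have eqS : \sum_i `|c + x i| ^+ 2 = \sum_(i : I) c ^+ 2 + \sum_i `|x i| ^+ 2.
  (* The cross terms of the expanded squares cancel: [c] is real and the [x i] sum to zero. *)
  have xx0 : \sum_i c * (x i + (x i)^*) = 0.
    by rewrite -mulr_sumr big_split /= -rmorph_sum x0 rmorph0 addr0 mulr0.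
  rewrite -[RHS]addr0 -[X in _ = _ + X]xx0 -!big_split /=.
  apply: eq_bigr => i _.
  by rewrite !normCK rmorphD /= cJ; ring.
have le0 : \sum_i `|x i| ^+ 2 <= 0.
  rewrite -(lerD2l (\sum_(i : I) c ^+ 2)) addr0 -eqS; apply: ler_sum => i _.
  by rewrite lerXn2r ?nnegrE.
have x2 i : true -> 0 <= `|x i| ^+ 2 by move=> _; rewrite exprn_ge0.
have /eqP : \sum_i `|x i| ^+ 2 = 0 by apply/le_anti; rewrite le0 sumr_ge0.
rewrite psumr_eq0 // => /allP h i.
by have := h i (mem_index_enum i); rewrite sqrf_eq0 normr_eq0 => /eqP.
Qed.

Lemma leigenvalueP {F : fieldType} {uT : vectType F} (T : 'End(uT)) (a : F) :
  reflect (exists2 v, v != 0 & T v = a *: v) (passmx.leigenvalue T a).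
Proof.
rewrite /passmx.leigenvalue /passmx.leigenspace -subv0.
apply: (iffP idP) => [/subvPn[v]|[v v0 Tv]].
  rewrite memv_ker memv0 add_lfunE opp_lfunE scale_lfunE id_lfunE subr_eq0.
  by move=> /eqP Tv v0; exists v.
apply/subvPn; exists v; rewrite ?memv0 // memv_ker.
by rewrite add_lfunE opp_lfunE scale_lfunE id_lfunE subr_eq0 Tv.
Qed.

Lemma conj_real_complex {R : realType} (x : R) : (x%:C%C : R[i])^* = x%:C%C.
Proof. exact: conjc_real. Qed.

(** * Inner products, rank-one error operators and optimality *)

Section Inner.
Context {R : realType} {d n : nat}.
Implicit Types (f g : 'cV[R[i]]_d) (Phi Psi : 'I_n -> 'cV[R[i]]_d).

Lemma innerDl f1 f2 g : inner (f1 + f2) g = inner f1 g + inner f2 g.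
Proof.
by rewrite -big_split; apply: eq_bigr => j _; rewrite mxE mulrDl.
Qed.

Lemma innerZl a f g : inner (a *: f) g = a * inner f g.
Proof. by rewrite mulr_sumr; apply: eq_bigr => j _; rewrite mxE mulrA. Qed.

Lemma innerBl f1 f2 g : inner (f1 - f2) g = inner f1 g - inner f2 g.
Proof. by rewrite innerDl -scaleN1r innerZl mulN1r. Qed.

Lemma inner_sumr f Phi : inner f (\sum_i Phi i) = \sum_i inner f (Phi i).
Proof.
rewrite exchange_big; apply: eq_bigr => j _ /=.
by rewrite summxE rmorph_sum mulr_sumr.
Qed.

Lemma inner_suml Phi g : inner (\sum_i Phi i) g = \sum_i inner (Phi i) g.
Proof.
by rewrite exchange_big; apply: eq_bigr => j _; rewrite summxE mulr_suml.
Qed.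

Lemma innerC f g : (inner f g)^* = inner g f.
Proof.
by rewrite rmorph_sum; apply: eq_bigr => j _ /=; rewrite rmorphM /= conjCK mulrC.
Qed.

Lemma inner0r f : inner f 0 = 0.
Proof. by rewrite /inner big1 // => j _; rewrite mxE rmorph0 mulr0. Qed.

Lemma inner0l g : inner 0 g = 0.
Proof. by rewrite /inner big1 // => j _; rewrite mxE mul0r. Qed.

Lemma inner_delta l g : inner (delta_mx l 0) g = (g l 0)^*.
Proof.
rewrite /inner (bigD1 l) //= big1 ?addr0 => [|j jl].
  by rewrite mxE !eqxx mul1r.
by rewrite mxE (negPf jl) mul0r.
Qed.

Lemma normc_normE (a : R[i]) : `|a| = (Normc.normc a)%:C%C.
Proof. by case: a. Qed.

Lemma error_op1E Phi Psi i f :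
  error_op Phi Psi [set i]%SET f = inner f (Phi i) *: Psi i.
Proof. by rewrite lfunE /= /partial_sum big_set1. Qed.

(** The range lies in the line of [Psi i], so the only possible eigenvalues are 0 and
    [inner (Psi i) (Phi i)]. *)
Lemma spectral_radius_error1 Phi Psi i : (0 < d)%N ->
  spectral_radius (error_op Phi Psi [set i]%SET)
  = Normc.normc (inner (Psi i) (Phi i)).
Proof.
move=> d0; set c := inner _ _; set T := error_op _ _ _.
have ev : passmx.leigenvalue T c.
  (* If [Psi i] vanishes the operator is 0; [0 < d] supplies a nonzero vector in its kernel. *)
  apply/leigenvalueP; have [Psi0|Psi0] := eqVneq (Psi i) 0.
    exists (delta_mx (Ordinal d0) 0).
      apply/eqP => /matrixP/(_ (Ordinal d0) 0) /eqP.
      by rewrite !mxE !eqxx oner_eq0.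
    by rewrite error_op1E /c Psi0 inner0l scale0r scaler0.
  by exists (Psi i) => //; rewrite error_op1E.
have ub : ubound [set Normc.normc a | a in [set a | passmx.leigenvalue T a]]%classic
            (Normc.normc c).
  move=> _ [a /leigenvalueP[v v0 Tv] <-]; rewrite error_op1E in Tv.
  rewrite -lecR -!normc_normE.
  have [->|a0] := eqVneq a 0; first by rewrite normr0.
  suff -> : a = c by [].
  (* Pair [T v = a *: v] with [Phi i]; if [inner v (Phi i)] is 0, then [a *: v] is 0, which is
     excluded. *)
  have /eqP : inner v (Phi i) * (a - c) = 0.
    by rewrite mulrBr -[X in _ - X]innerZl Tv innerZl mulrC subrr.
  rewrite mulf_eq0 subr_eq0 => /orP[/eqP iv|/eqP //].
  move: Tv; rewrite iv scale0r => /esym/eqP.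
  by rewrite scaler_eq0 (negPf a0) (negPf v0).
apply/eqP; rewrite eq_le; apply/andP; split.
  by apply: ge_sup => //; exists (Normc.normc c); exists c.
by apply: ub_le_sup; [exists (Normc.normc c)|exists c].
Qed.

(** Sets of cardinality 1 are singletons; [0 <= c] covers the default value of the maximum. *)
Lemma rho_dual1_le Phi Psi (c : R) : (0 < d)%N -> 0 <= c ->
  rho_dual 1 Phi Psi <= c <-> forall i, `|inner (Psi i) (Phi i)| <= c%:C%C.
Proof.
move=> d0 c0; split=> [/bigmax_leP[_ le_c] i|le_c].
  by rewrite normc_normE lecR -spectral_radius_error1 // le_c ?cards1.
apply/bigmax_leP; split=> // _ /cards1P[i ->].
by rewrite spectral_radius_error1 // -lecR -normc_normE.
Qed.

Lemma rho_dual_ge0 r Phi Psi : 0 <= rho_dual r Phi Psi.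
Proof. exact: bigmax_ge_id. Qed.

(** By [zero_sum_ball], a dual whose value is at most [c] differs from [Q] by vectors with zero
    pairings, hence equals [Q]. *)
Lemma spectrally_optimal1_unique Phi Q (c : R) : (0 < d)%N -> (0 < n)%N ->
  0 <= c -> is_dual_frame Phi Q ->
  (forall i, inner (Q i) (Phi i) = c%:C%C) ->
  (forall Psi, is_dual_frame Phi Psi ->
     \sum_i inner (Psi i - Q i) (Phi i) = 0 /\
     ((forall i, inner (Psi i - Q i) (Phi i) = 0) -> Psi = Q)) ->
  [/\ spectrally_optimal 1 Phi Q,
      forall Psi, spectrally_optimal 1 Phi Psi -> Psi = Q
    & rho 1 Phi = c].
Proof.
move=> d0 n0 c0 dualQ Qc dualP.
have le_cQ Psi : is_dual_frame Phi Psi -> rho_dual 1 Phi Psi <= c -> Psi = Q.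
  move=> /dualP[sum0 eqQ] /rho_dual1_le le_c; apply: eqQ.
  apply: (@zero_sum_ball _ _ c%:C%C) => // [|i]; first by rewrite ler0c.
  by rewrite -(Qc i) innerBl addrC subrK Qc le_c.
have rhoQ : rho_dual 1 Phi Q = c.
  apply/eqP; rewrite eq_le; apply/andP; split.
    by apply/rho_dual1_le => // i; rewrite Qc ger0_norm ?ler0c.
  (* The maximum bounds each of its terms; evaluate at index 0. *)
  have /(_ d0 (rho_dual_ge0 _ _ _))[/(_ (lexx _)) + _] :=
    @rho_dual1_le Phi Q (rho_dual 1 Phi Q).
  by move=> /(_ (Ordinal n0)); rewrite Qc ger0_norm ?ler0c // lecR.
have c_lb : lbound
    [set rho_dual 1 Phi Psi | Psi in [set Psi | is_dual_frame Phi Psi]]%classic c.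
  move=> _ [Psi dualPsi <-]; rewrite leNgt; apply/negP => ltc.
  by move: (ltc); rewrite (le_cQ Psi) ?(ltW ltc) // rhoQ ltxx.
have rhoE : rho 1 Phi = c.
  apply/eqP; rewrite eq_le; apply/andP; split.
    by apply: ge_inf; [exists c|exists Q].
  by apply: lb_le_inf => //; exists c; exists Q.
split=> //; first by split; rewrite ?rhoE.
by move=> Psi [dualPsi]; rewrite rhoE => e; apply: le_cQ; rewrite ?e.
Qed.

End Inner.

(** * The Laplacian and the coordinates of its frames *)

Lemma laplacian_const1 {R : realType} {n} (e : rel 'I_n) :
  laplacian R e *m const_mx 1 = 0 :> 'cV_n.
Proof.
rewrite /laplacian mulmxBl mul_diag_mx; apply/matrixP => i j; rewrite !mxE.
apply/eqP; rewrite mulr1 subr_eq0 -sum1_card big_mkcond natr_sum; apply/eqP.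
by apply: eq_bigr => l _; rewrite !mxE inE mulr1; case: (e i l).
Qed.

(** The form is half the sum of [|x i 0 - x j 0| ^+ 2] over ordered adjacent pairs. *)
Lemma laplacian_psd {R : realType} {n} {e : rel 'I_n} (x : 'cV[R[i]]_n) :
  symmetric e -> 0 <= (x ^t* *m laplacian R e *m x) 0 0.
Proof.
move=> sym_e.
have qE : (x ^t* *m laplacian R e *m x) 0 0 =
    \sum_i \sum_j (e i j)%:R * (`|x i 0| ^+ 2 - (x i 0)^* * x j 0).
  rewrite -mulmxA mxE; apply: eq_bigr => i _.
  rewrite /laplacian mulmxBl mul_diag_mx !mxE -sum1_card big_mkcond natr_sum.
  rewrite mulr_suml -sumrB mulr_sumr; apply: eq_bigr => j _.
  by rewrite !mxE inE normCK; case: (e i j) => /=; ring.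
(* Double the form and swap [i] and [j] in one copy, so that paired terms complete the square. *)
rewrite -(pmulr_rge0 _ (ltr0n _ 2)) mulr_natl mulr2n {2}qE exchange_big qE.
rewrite -big_split sumr_ge0 // => i _; rewrite -big_split sumr_ge0 // => j _.
rewrite /= (sym_e j i) -mulrDr mulr_ge0 ?ler0n //.
suff -> : `|x i 0| ^+ 2 - (x i 0)^* * x j 0 + (`|x j 0| ^+ 2 - (x j 0)^* * x i 0)
  = `|x i 0 - x j 0| ^+ 2 by rewrite exprn_ge0.
by rewrite !normCK rmorphB; ring.
Qed.

(* In the notation of the definition, [W] is [M1^t*] and [s j] is the square
   root of the eigenvalue [lam_j]; the last column of [M] is constant of
   modulus [1 / sqrt n]. *)
Lemma LG_frame_coords {R : realType} {k} {e : rel 'I_k.+1}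
    {Phi : 'I_k.+1 -> 'cV[R[i]]_k} :
  symmetric e -> is_LG_frame e Phi ->
  exists (s : 'I_k -> R) (W : 'I_k -> 'I_k.+1 -> R[i]),
  [/\ forall j, 0 < s j,
      forall i j, Phi i j 0 = (s j)%:C%C * W j i,
      forall j l, \sum_i W j i * (W l i)^* = (j == l)%:R,
      forall j, \sum_i W j i = 0
    & forall i h, \sum_j W j i * (W j h)^* = (i == h)%:R - (k.+1%:R)^-1].
Proof.
move=> sym_e [_ [le_k [M [lam [unitM lam_n0 LE PhiE]]]]].
have {le_k PhiE} : forall i j, Phi i j 0 =
    (Num.sqrt (lam 0 (widen_ord (leqnSn k) j)))%:C%C
    * (M i (widen_ord (leqnSn k) j))^*.
  move=> i j; rewrite PhiE (eq_irrelevance le_k (leqnSn k)) -mulmxA mul_diag_mx.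
  by rewrite -colE !mxE.
set w := widen_ord _ => PhiE.
have MMt : M *m M ^t* = 1%:M by apply/unitarymxP.
have MtM : M ^t* *m M = 1%:M by apply: mulmx1C.
have lam_n0w j : lam 0 (w j) != 0 by rewrite lam_n0 /= ltn_ord.
(* [lam 0 j] is the value of the Laplacian form at column [j] of [M]. *)
have lam_ge0 j : 0 <= lam 0 j.
  have := laplacian_psd (col j M) sym_e; rewrite LE colE trmx_mul map_mxM.
  rewrite !mulmxA -[_ *m M ^t* *m M]mulmxA MtM mulmx1 -[_ *m M ^t* *m M]mulmxA.
  rewrite MtM mulmx1 trmx_delta map_delta_mx -rowE -colE.
  by rewrite !mxE eqxx mulr1n ler0c.
(* [a] holds the coordinates of the all-ones vector in the eigenbasis; only the last, in the kernel,
   survives. *)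
pose a : 'cV_k.+1 := M ^t* *m const_mx 1.
have a0 j : a (w j) 0 = 0.
  have Da0 : diag_mx (map_mx (real_complex R) lam) *m a = 0.
    have := congr1 (mulmx (M ^t*)) (@laplacian_const1 R _ e).
    by rewrite LE mulmx0 !mulmxA MtM mul1mx -mulmxA.
  have /eqP := congr1 (fun A : 'cV_k.+1 => A (w j) 0) Da0.
  rewrite mul_diag_mx !mxE mulf_eq0 => /orP[|/eqP//].
  by rewrite fmorph_eq0 (negPf (lam_n0w j)).
have Ma i : M i ord_max * a ord_max 0 = 1.
  have : (M *m a) i 0 = 1 by rewrite mulmxA MMt mul1mx mxE.
  rewrite mxE big_ord_recr big1 /= ?add0r => [->//|j _].
  by rewrite -/w a0 mulr0.
have Mmax i h : (M i ord_max)^* * M h ord_max = (k.+1%:R)^-1.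
  have Mconst l : M l ord_max = M h ord_max.
    have a_n0 : a ord_max 0 != 0.
      by apply: contra_eqN (Ma h) => /eqP ->; rewrite mulr0 eq_sym oner_eq0.
    by apply: (mulIf a_n0); rewrite !Ma.
  have := congr1 (fun A : 'M_k.+1 => A ord_max ord_max) MtM; rewrite !mxE eqxx.
  under eq_bigr do rewrite !mxE Mconst.
  rewrite sumr_const card_ord -[LHS]mulr_natr (Mconst i) => MM1.
  have k0 : k.+1%:R != 0 :> R[i] by rewrite pnatr_eq0.
  by apply: (mulIf k0); rewrite MM1 mulVf.
exists (fun j => Num.sqrt (lam 0 (w j))), (fun j i => (M i (w j))^*).
split=> [j|//|j l|j|i h].
- by rewrite sqrtr_gt0 lt0r lam_n0w lam_ge0.
- have := congr1 (fun A : 'M_k.+1 => A (w j) (w l)) MtM; rewrite !mxE.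
  rewrite (_ : (w j == w l) = (j == l)) // => <-.
  by apply: eq_bigr => i _; rewrite !mxE conjCK.
- by rewrite -[RHS](a0 j) mxE; apply: eq_bigr => i _; rewrite !mxE mulr1.
(* Split the last column, worth [1 / n], off the orthonormality of the rows of [M]. *)
- have := congr1 (fun A : 'M_k.+1 => A h i) MMt; rewrite !mxE big_ord_recr /=.
  rewrite eq_sym => <-; rewrite !mxE mulrC Mmax addrK.
  by apply: eq_bigr => j _; rewrite !mxE conjCK mulrC.
Qed.

(** * Frames that rescale orthonormal rows *)

Lemma reconstruction_diag {R : realType} {d n : nat} {W : 'I_d -> 'I_n -> R[i]}
    {t u : 'I_d -> R} {T U : 'I_n -> 'cV[R[i]]_d} (f : 'cV[R[i]]_d) (j : 'I_d) :
  (forall j l, \sum_i W j i * (W l i)^* = (j == l)%:R) ->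
  (forall i j, T i j 0 = (t j)%:C%C * W j i) ->
  (forall i j, U i j 0 = (u j)%:C%C * W j i) ->
  (\sum_i inner f (T i) *: U i) j 0 = (t j * u j)%:C%C * f j 0.
Proof.
move=> WW TE UE; rewrite summxE.
have -> : \sum_i (inner f (T i) *: U i) j 0 =
    \sum_l \sum_i f l 0 * (t l)%:C%C * (u j)%:C%C * (W j i * (W l i)^*).
  rewrite exchange_big; apply: eq_bigr => i _; rewrite mxE mulr_suml.
  apply: eq_bigr => l _; rewrite TE UE rmorphM /=.
  by rewrite conj_real_complex; ring.
under eq_bigr do rewrite -mulr_sumr WW.
rewrite (bigD1 j) //= eqxx big1 ?addr0 => [|l /negPf lj].
  by rewrite rmorphM /=; ring.
by rewrite eq_sym lj mulr0.
Qed.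

(** The frame operator is diagonal with entries [t j ^+ 2], so any positive bounds enclosing these
    entries will do. *)
Lemma frame_diag {R : realType} {d n : nat} {W : 'I_d -> 'I_n -> R[i]}
    {t : 'I_d -> R} {T : 'I_n -> 'cV[R[i]]_d} :
  (forall j l, \sum_i W j i * (W l i)^* = (j == l)%:R) ->
  (forall i j, T i j 0 = (t j)%:C%C * W j i) -> (forall j, 0 < t j) ->
  is_frame T.
Proof.
move=> WW TE t0.
(* Adding 1 to the sums makes the bounds positive and separates them: [A <= 1 <= B]. *)
have ge1 (v : 'I_d -> R) : 1 <= 1 + \sum_j v j ^+ 2.
  by rewrite lerDl sumr_ge0 // => j _; rewrite sqr_ge0.
have le_sum (v : 'I_d -> R) l : v l ^+ 2 <= 1 + \sum_j v j ^+ 2.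
  rewrite (bigD1 l) //= addrCA lerDl addr_ge0 ?sumr_ge0 // => j _.
  by rewrite sqr_ge0.
pose a := 1 + \sum_j (t j)^-1 ^+ 2; have a0 : 0 < a by apply: lt_le_trans (ge1 _).
exists a^-1, (1 + \sum_j t j ^+ 2); split=> [||f].
- by rewrite invr_gt0.
- by apply: le_trans (ge1 _); rewrite invf_le1 // ge1.
have -> : \sum_i `|inner f (T i)| ^+ 2 =
    \sum_j (t j ^+ 2)%:C%C * `|f j 0| ^+ 2.
  transitivity (inner (\sum_i inner f (T i) *: T i) f).
    rewrite inner_suml; apply: eq_bigr => i _.
    by rewrite innerZl normCK innerC.
  apply: eq_bigr => j _.
  by rewrite (reconstruction_diag f j WW TE TE) normCK mulrA -expr2.
rewrite /inner !mulr_sumr; apply/andP; split; apply: ler_sum => j _.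
  rewrite -normCK ler_wpM2r ?exprn_ge0 // lecR.
  by rewrite -[leRHS]invrK lef_pV2 ?posrE ?invr_gt0 ?exprn_gt0 // -exprVn le_sum.
by rewrite -normCK ler_wpM2r ?exprn_ge0 // lecR le_sum.
Qed.

(** * Duals of a graph frame *)

Theorem theorem3p2 (R : realType) (n : nat) (e : rel 'I_n)
    (Phi : 'I_n -> 'cV[R[i]]_(n.-1)) :
  (2 <= n)%N -> simple_graph e -> connected_graph e -> is_LG_frame e Phi ->
  [/\ spectrally_optimal 1 Phi (canonical_dual Phi),
      forall Psi : 'I_n -> 'cV[R[i]]_(n.-1),
        spectrally_optimal 1 Phi Psi -> Psi = canonical_dual Phi &
      rho 1 Phi = (n%:R - 1) / n%:R].
Proof.
case: n e Phi => [//|[//|k]] e Phi _ [sym_e _] _ frPhi.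
have [s [W [s0 PhiE WW W0 WtW]]] := LG_frame_coords sym_e frPhi.
have sn0 j : s j != 0 by rewrite gt_eqF.
have sV j : (s j)%:C%C * ((s j)^-1)%:C%C = 1 by rewrite -rmorphM /= divff.
(* The frame operator is diagonal with entries [s j * s j]; its inverse turns the factor [s j] into
   [(s j)^-1]. *)
pose Q (i : 'I_k.+2) : 'cV[R[i]]_k.+1 := \col_j (((s j)^-1)%:C%C * W j i).
have QE i j : Q i j 0 = ((s j)^-1)%:C%C * W j i by rewrite mxE.
have frame_opE f j : frame_op Phi f j 0 = (s j * s j)%:C%C * f j 0.
  rewrite lfunE /= /partial_sum -(reconstruction_diag f j WW PhiE PhiE).
  by congr ((_ : 'cV_ _) _ _); apply: eq_bigl => i; rewrite inE.
have ker0 : lker (frame_op Phi) == 0%VS.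
  apply/lker0P => f g /matrixP fg; apply/matrixP => j l; rewrite ord1.
  have := fg j 0; rewrite !frame_opE; apply: mulfI.
  by rewrite fmorph_eq0 mulf_neq0.
have -> : canonical_dual Phi = Q.
  apply/funext => i; rewrite /canonical_dual -[RHS](lker0_lfunK ker0).
  congr (_ _); apply/matrixP => j l; rewrite ord1 frame_opE QE PhiE rmorphM /=.
  by rewrite -[LHS]mulr1 -(sV j); ring.
have c_ge0 : 0 <= (k.+2%:R - 1) / k.+2%:R :> R.
  by rewrite divr_ge0 ?ler0n // subr_ge0 ler1n.
have dualQ : is_dual_frame Phi Q.
  split; first by apply: frame_diag WW QE _ => j; rewrite invr_gt0.
  move=> f; split; apply/matrixP => j l; rewrite ord1.
    by rewrite (reconstruction_diag f j WW PhiE QE) divff // mul1r.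
  by rewrite (reconstruction_diag f j WW QE PhiE) mulVf // mul1r.
apply: spectrally_optimal1_unique => // [i|Psi dualPsi].
  (* The scalings cancel, leaving a diagonal entry of [I - J / n]. *)
  transitivity (\sum_j W j i * (W j i)^*).
    apply: eq_bigr => j _; rewrite QE PhiE rmorphM /= conj_real_complex.
    by rewrite -[RHS]mulr1 -(sV j); ring.
  by rewrite WtW eqxx mulrBl divff ?pnatr_eq0 // mul1r rmorphB fmorphV rmorph_nat.
(* Equal differences must equal their mean. *)
pose u : 'cV[R[i]]_k.+1 := (k.+2%:R)^-1 *: \sum_i (Psi i - Q i).
(* [Psi - Q] annihilates the row space of [Phi], whose orthogonal complement
   consists of the constant vectors. *)
have PsiBQ h : Psi h - Q h = u.
  apply/matrixP => j l; rewrite {l}ord1 [RHS]mxE summxE.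
  (* Both duals reconstruct [delta_mx l 0]; subtract and cancel [s l]. *)
  have WU l : \sum_i (W l i)^* * (Psi i - Q i) j 0 = 0.
    have [_ /(_ (delta_mx l 0))[PsiK _]] := dualPsi.
    have [_ /(_ (delta_mx l 0))[+ _]] := dualQ.
    rewrite [LHS]PsiK => /(congr1 (fun f : 'cV_k.+1 => f j 0))/eqP.
    rewrite -subr_eq0 !summxE -sumrB => /eqP eq0.
    have sl0 : (s l)%:C%C != 0 :> R[i] by rewrite fmorph_eq0.
    apply: (mulfI sl0); rewrite mulr0 -[RHS]eq0 mulr_sumr.
    apply: eq_bigr => i _; rewrite !inner_delta PhiE rmorphM /=.
    by rewrite conj_real_complex !mxE; ring.
  (* Applying [I - J / n] to the differences gives 0, so each equals the mean. *)
  have /eqP : \sum_l W l h * \sum_i (W l i)^* * (Psi i - Q i) j 0 = 0.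
    by apply: big1 => l _; rewrite WU mulr0.
  under eq_bigr do rewrite mulr_sumr.
  rewrite exchange_big /=.
  under eq_bigr => i _.
    under eq_bigr do rewrite mulrA.
    rewrite -mulr_suml WtW mulrBl.
    over.
  rewrite sumrB -mulr_sumr subr_eq0 (bigD1 h) //= big1 ?addr0 => [/eqP <-|i].
    by rewrite eqxx mul1r.
  by rewrite eq_sym => /negPf ->; rewrite mul0r.
split=> [|u0].
  under eq_bigr do rewrite PsiBQ.
  rewrite -inner_sumr (_ : \sum_i Phi i = 0) ?inner0r //.
  apply/matrixP => j l; rewrite ord1 summxE mxE.
  by under eq_bigr do rewrite PhiE; rewrite -mulr_sumr W0 mulr0.
(* [Q] reconstructs [u] from its pairings with [Phi], all zero here. *)
apply/funext => h; apply/eqP; rewrite -subr_eq0 PsiBQ; apply/eqP.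
have [_ /(_ u)[-> _]] := dualQ.
by apply: big1 => i _; rewrite -(PsiBQ i) u0 scale0r.
Qed.
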